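(* Let $c$ be a rational number and let $f_c(x)=x^2+c$. (a) If $c>\frac14$, then $\mathrm{PrePer}(f_c)\cap\mathbb{Q}^{\mathrm{tr}}=\emptyset$. (b) If $-2<c\le \frac14$, then $\mathrm{PrePer}(f_c)\cap\mathbb{Q}^{\mathrm{tr}}$ is nonempty and finite. (c) If $c\le -2$, then $\mathrm{PrePer}(f_c)\subseteq\mathbb{Q}^{\mathrm{tr}}$; in particular, $\mathrm{PrePer}(f_c)\cap\mathbb{Q}^{\mathrm{tr}}$ is infinite.
   Context: For a polynomial $f$ with coefficients in $\overline{\mathbb{Q}}$, $f^n$ denotes the $n$-fold composition of $f$ with itself ($f^0$ is the identity). An algebraic number $\alpha\in\overline{\mathbb{Q}}$ is a preperiodic point of $f$ if $f^n(\alpha)=f^m(\alpha)$ for some integers $0\le m<n$. $\mathrm{PrePer}(f)$ denotes the set of all preperiodic points of $f$ in $\overline{\mathbb{Q}}$. An algebraic number $\alpha$ is totally real if its minimal polynomial over $\mathbb{Q}$ splits completely over $\mathbb{R}$ (equivalently, every complex embedding $\mathbb{Q}(\alpha)\hookrightarrow\mathbb{C}$ has image contained in $\mathbb{R}$). $\mathbb{Q}^{\mathrm{tr}}$ denotes the set of all totally real algebraic numbers. *)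

(* Defs.v *)
From mathcomp Require Import all_boot all_order all_algebra all_field.
From mathcomp Require Import boolp classical_sets cardinality reals.

Set Implicit Arguments.
Unset Strict Implicit.
Unset Printing Implicit Defensive.

Import Order.TTheory GRing.Theory Num.Theory.
Local Open Scope classical_set_scope.
Local Open Scope ring_scope.

Definition poly_iter (f : {poly algC}) (n : nat) : {poly algC} :=
  iter n (fun g => f \Po g) 'X.

Definition PrePer (f : {poly algC}) : set algC :=
  [set a | exists m n : nat,
     (m < n)%N /\ (poly_iter f n).[a] = (poly_iter f m).[a]].

(* [minCpoly a] is the minimal polynomial of [a] over the rationals, stored
   with coefficients in [algC]; [p] is the same polynomial with rational
   coefficients (it exists and is unique, see [minCpolyP]), so that it can be
   mapped to [R]. *)
Definition totally_real (R : realType) (a : algC) : Prop :=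
  exists2 p : {poly rat}, minCpoly a = map_poly ratr p &
    exists rs : seq R, map_poly ratr p = \prod_(r <- rs) ('X - r%:P).

Definition Qtr (R : realType) : set algC := [set a | totally_real R a].

Definition quad (c : rat) : {poly algC} := 'X^2 + (ratr c)%:P.

(* Main.v *)
(** For [c > 1/4], [x ^ 2 + c > x] on the reals, so real orbits are strictly
    increasing.

    For [c <= -2], let [b >= 2] be the larger fixed point.  The excess
    [|z - b| + |z + b| - 2 b] of a complex [z] over the segment [[-b, b]] is at
    least quadrupled by [z |-> z ^ 2 + c], so it vanishes at preperiodic points,
    which are therefore real.  The backward orbit of [-b] is infinite.

    For [-2 < c <= 1/4], a fixed point is totally real.  For finiteness, take a
    finite Galois-stable set of [d] totally real preperiodic points; its
    discriminant is a nonzero rational.  It is the square of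
    [det (P_k (alpha_i))] for any monic [P_k] of degree [k].  Taking for [P_k] a
    product of powers of [x] and of a high iterate of [x ^ 2 + c], whose values at
    preperiodic points are integral up to the denominator of [c], bounds the
    discriminant below by [exp (- eps d ^ 2)].  Real preperiodic points lie in
    [[-t, t]] with [t < 2], of capacity [t / 2 < 1]: Chebyshev polynomials bound
    the discriminant above by [exp (- delta d ^ 2)] up to a factor
    [exp (O (d log d))].  Hence [d] is bounded. *)

Require Import Defs.
From mathcomp Require Import all_boot all_order all_algebra all_fingroup all_field.
From mathcomp Require Import boolp classical_sets cardinality reals.
From mathcomp Require finmap.
From mathcomp Require Import complex ring lra.

Set Implicit Arguments.
Unset Strict Implicit.
Unset Printing Implicit Defensive.

Import Order.TTheory GRing.Theory Num.Theory.
Local Open Scope classical_set_scope.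
Local Open Scope ring_scope.

(** * Preperiodicity over an arbitrary ring *)

Definition qmap (L : nzRingType) (c x : L) : L := x ^+ 2 + c.

(** Stated over any ring so that it can be carried between [algC], [R] and [R[i]]. *)
Definition preper (L : nzRingType) (c x : L) : Prop :=
  exists m n, (m < n)%N /\ iter n (qmap c) x = iter m (qmap c) x.

Definition qiter (c : rat) (n : nat) : {poly rat} :=
  iter n (fun g => g ^+ 2 + c%:P) 'X.

Lemma horner_qiter (L : numFieldType) (c : rat) n (x : L) :
  (map_poly ratr (qiter c n)).[x] = iter n (qmap (ratr c)) x.
Proof.
elim: n => [|n IHn]; first by rewrite /= map_polyX hornerX.
by rewrite /= rmorphD rmorphXn /= map_polyC hornerD horner_exp hornerC IHn.
Qed.

Lemma PrePer_quad (c : rat) : PrePer (quad c) = [set a | preper (ratr c) a].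
Proof.
have iterE n a : (poly_iter (quad c) n).[a] = iter n (qmap (ratr c)) a.
  elim: n => [|n IHn]; first by rewrite /= hornerX.
  by rewrite /= horner_comp IHn !(hornerD, hornerXn, hornerC).
by apply/seteqP; split=> a [m [n []]]; rewrite ?iterE => mn E; exists m, n;
  rewrite ?iterE.
Qed.

Lemma preper_iter (L : nzRingType) (c x : L) k :
  preper c x -> preper c (iter k (qmap c) x).
Proof.
case=> m [n [mn E]]; exists m, n; split=> //.
by rewrite -!iterD addnC iterD E -iterD addnC iterD.
Qed.

Lemma root_qiterB (L : numFieldType) (c : rat) m n (x : L) :
  root (map_poly ratr (qiter c n - qiter c m)) x
  = (iter n (qmap (ratr c)) x == iter m (qmap (ratr c)) x).
Proof. by rewrite rmorphB rootE hornerD hornerN !horner_qiter subr_eq0. Qed.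

(** A relation between two iterates at [a] is the vanishing of a rational polynomial, hence
    divisible by the minimal polynomial; it therefore holds at every conjugate, in any field. *)
Lemma preper_conjugate (L : numFieldType) (c : rat) (q : {poly rat}) (a : algC)
    (z : L) :
  minCpoly a = map_poly ratr q -> preper (ratr c) a ->
  root (map_poly ratr q) z -> preper (ratr c) z.
Proof.
have [q' [-> _] q'P] := minCpolyP a; move=> /(map_poly_inj _) <-.
case=> m [n [mn /eqP]]; rewrite -root_qiterB q'P => /dvdpP[g E] qz.
exists m, n; split=> //; apply/eqP; rewrite -root_qiterB E rmorphM rootM qz.
by rewrite orbT.
Qed.

Lemma minCpoly_split_nonconst (L : numFieldType) (a : algC) (q : {poly rat})
    (rs : seq L) :
  minCpoly a = map_poly ratr q ->
  map_poly ratr q = \prod_(r <- rs) ('X - r%:P) -> rs != [::].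
Proof.
move=> qa E; apply: contraPneq (root_minCpoly a) => rs0; rewrite qa.
have : size (map_poly ratr q : {poly L}) = 1%N by rewrite E rs0 big_nil size_poly1.
rewrite size_map_poly => sq.
have /size_poly1P[k k0 ->] : size q == 1%N by rewrite sq.
by apply/negP; rewrite map_polyC rootC fmorph_eq0.
Qed.

(** Since [s^2 - s + c] increases for [s >= 1], it stays positive beyond [t], so absolute values
    grow strictly along an orbit that starts outside [(-t, t)]. *)
Lemma preper_real_le (R : realDomainType) (c t x : R) :
  1 <= t -> 0 < t ^+ 2 - t + c -> preper c x -> `|x| < t.
Proof.
move=> t1 tc [m [n [mn E]]]; rewrite ltNge; apply/negP => tx.
have step y : t <= `|y| -> `|y| < `|qmap c y|.
  move=> ty; apply: lt_le_trans (ler_norm _); rewrite /qmap.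
  by rewrite -[y ^+ 2]real_normK ?num_real //; nra.
have gt k : t <= `|iter k (qmap c) x|.
  by elim: k => // k IHk; apply: le_trans IHk (ltW (step _ IHk)).
have : {homo (fun k => `|iter k (qmap c) x|) : i j / (i < j)%N >-> i < j}.
  by apply: homo_ltn => [? ? ?|k]; [apply: lt_trans | exact: step].
by move=> /(_ _ _ mn); rewrite E ltxx.
Qed.

(** * The case [c > 1/4] *)

Lemma no_real_preper (R : realFieldType) (c x : R) : 1 / 4 < c -> ~ preper c x.
Proof.
move=> c4 [m [n [mn E]]].
have : {homo (fun k => iter k (qmap c) x) : i j / (i < j)%N >-> i < j}.
  apply: homo_ltn => [? ? ?|k]; first by apply: lt_trans.
  rewrite iterS; move: (iter k _ x) => y; rewrite /qmap.
  have := sqr_ge0 (y - 1 / 2); nra.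
by move=> /(_ _ _ mn); rewrite E ltxx.
Qed.

Lemma PrePer_Qtr_empty (R : realType) (c : rat) :
  1 / 4 < c -> PrePer (quad c) `&` Qtr R = set0.
Proof.
move=> c4; apply/seteqP; split=> // a []; rewrite PrePer_quad => /= pa [q qa [rs E]].
have := minCpoly_split_nonconst qa E; case: rs E => // r rs E _.
apply: (@no_real_preper R (ratr c) r).
  by have := ltr_rat R (1 / 4) c; rewrite c4 rmorphM fmorphV rmorph1 rmorph_nat.
by apply: preper_conjugate qa pa _; rewrite E root_prod_XsubC mem_head.
Qed.

(** * The case [c <= -2] *)

Lemma focal_sum_ge (C : numFieldType) (b z : C) :
  0 <= b -> 2 * b <= `|z - b| + `|z + b|.
Proof.
move=> b0; have -> : 2 * b = `|(z + b) - (z - b)|.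
  have -> : z + b - (z - b) = 2 * b by ring.
  by rewrite ger0_norm // mulr_ge0.
by rewrite [leRHS]addrC; apply: ler_normB.
Qed.

(** Here [c = b - b^2], so [b] is fixed. With [e = s + t - 2b], the factorization
    [f(z) - b = (z - b)(z + b)] and the parallelogram law bound the new excess below by
    [2be + e^2/2], which is at least [4e]. *)
Lemma focal_excess_qmap (C : numClosedFieldType) (b z : C) : 2 <= b ->
  4 * (`|z - b| + `|z + b| - 2 * b)
  <= `|qmap (b - b ^+ 2) z - b| + `|qmap (b - b ^+ 2) z + b| - 2 * b.
Proof.
move=> b2; have b0 : 0 <= b by apply: le_trans b2.
have bconj : b^* = b by apply: conj_Creal; apply: ger0_real.
set s := `|z - b|; set t := `|z + b|.
have par : s ^+ 2 + t ^+ 2 = 2 * `|z| ^+ 2 + 2 * b ^+ 2.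
  by rewrite !normCK rmorphB rmorphD /= bconj; ring.
have st := focal_sum_ge z b0; rewrite -/s -/t in st.
have -> : qmap (b - b ^+ 2) z - b = (z - b) * (z + b) by rewrite /qmap; ring.
have -> : qmap (b - b ^+ 2) z + b = z ^+ 2 - b * (b - 2) by rewrite /qmap; ring.
rewrite normrM -/s -/t -subr_ge0.
have h : `|z| ^+ 2 - b * (b - 2) <= `|z ^+ 2 - b * (b - 2)|.
  apply: le_trans (lerB_dist _ _).
  by rewrite normrX [`|b * _|]ger0_norm // mulr_ge0 // subr_ge0.
rewrite -subr_ge0 in h; rewrite -subr_ge0 in st; rewrite -subr_ge0 in b2.
set w := `|_ - b * _| in h *.
have -> : s * t + w - 2 * b - 4 * (s + t - 2 * b) =
  (w - (`|z| ^+ 2 - b * (b - 2))) + (2 * (b - 2) * (s + t - 2 * b)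
    + (s + t - 2 * b) ^+ 2 / 2).
  have -> : `|z| ^+ 2 = (s ^+ 2 + t ^+ 2) / 2 - b ^+ 2 by rewrite par; field.
  by field.
rewrite addr_ge0 // addr_ge0 //; first by rewrite !mulr_ge0.
by rewrite mulr_ge0 ?exprn_ge0 ?invr_ge0.
Qed.

Lemma preper_real (C : numClosedFieldType) (b z : C) :
  2 <= b -> preper (b - b ^+ 2) z -> z \is Num.real.
Proof.
move=> b2 [m [n [mn E]]]; have b0 : 0 <= b by apply: le_trans b2.
pose e (y : C) := `|y - b| + `|y + b| - 2 * b.
have e0 y : 0 <= e y.
  by rewrite subr_ge0 focal_sum_ge.
have ge k y : 4 ^+ k * e y <= e (iter k (qmap (b - b ^+ 2)) y).
  elim: k => [|k IHk]; first by rewrite mul1r.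
  rewrite exprS -mulrA iterS; apply: le_trans (focal_excess_qmap _ b2).
  by rewrite ler_pM2l.
(* The point [f^m(z)] returns to itself after [n - m > 0] steps, while its excess is multiplied by
   at least [4^(n-m) > 1]. *)
have em : e (iter m (qmap (b - b ^+ 2)) z) = 0.
  have := ge (n - m)%N (iter m (qmap (b - b ^+ 2)) z).
  rewrite -iterD subnK ?E; last exact: ltnW.
  rewrite -subr_ge0 -{1}[e _]mul1r -mulrBl => h; apply/eqP.
  rewrite eq_le e0 andbT; move: h; rewrite nmulr_rge0 // subr_lt0.
  by rewrite exprn_egt1 ?ltr1n // subn_eq0 -ltnNge.
have ez : e z = 0.
  apply/eqP; rewrite eq_le e0 andbT; have := ge m z; rewrite em.
  by rewrite pmulr_rle0 ?exprn_gt0.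
(* Zero excess is equality in the triangle inequality: [b - z] and [z + b] share a direction [u],
   which is real because their sum [2b] is. *)
have : `|(b - z) + (z + b)| = `|b - z| + `|z + b|.
  rewrite distrC; move/eqP: ez; rewrite subr_eq0 => /eqP ->.
  have -> : b - z + (z + b) = 2 * b by ring.
  by rewrite ger0_norm // mulr_ge0.
case/normCDeq => u u1 [E1 E2].
have ub : 2 * b = (`|b - z| + `|z + b|) * u.
  by rewrite [RHS]mulrDl -E1 -E2; ring.
have b2r : 2 * b != 0 by rewrite mulf_neq0 // gt_eqF // (lt_le_trans _ b2).
have ur : u \is Num.real.
  have -> : u = 2 * b / (`|b - z| + `|z + b|).
    rewrite ub mulrAC mulfV ?mul1r //; apply: contraNneq b2r => s0.
    by rewrite ub s0 mul0r.
  by rewrite rpred_div ?rpredD ?rpredM ?normr_real ?ger0_real.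
have -> : z = (z + b) - b by ring.
rewrite E2; apply: rpredB; last exact: ger0_real.
by apply: rpredM (normr_real _) ur.
Qed.

Lemma fixed_point_ge2 (C : numClosedFieldType) (c : rat) :
  c <= -2 -> exists2 b : C, 2 <= b & ratr c = b - b ^+ 2.
Proof.
move=> c2; exists ((1 + sqrtC (1 - 4 * ratr c)) / 2); last first.
  have := sqrtCK (1 - 4 * ratr c : C); move: (sqrtC _) => s E.
  have -> : ratr c = (1 - s ^+ 2) / 4 :> C by rewrite E; field.
  by field.
have c9 : 9 <= 1 - 4 * ratr c :> C.
  have -> : 1 - 4 * ratr c = ratr (1 - 4 * c) :> C.
    by rewrite rmorphB rmorphM /= rmorph1 rmorph_nat.
  by rewrite -(ratr_nat C 9) ler_rat; lra.
have : 3 <= sqrtC (1 - 4 * ratr c : C).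
  rewrite -(@ler_pXn2r _ 2%N) ?nnegrE ?sqrtC_ge0 ?(le_trans _ c9) //.
  by rewrite sqrtCK -natrX.
rewrite ler_pdivlMr // -lerBlDl.
by have -> : 2 * 2 - 1 = 3 :> C by ring.
Qed.

(** The minimal polynomial is split in [R[i]]; its roots there are preperiodic, hence real, and the
    factorization descends to [R]. *)
Lemma PrePer_sub_Qtr (R : realType) (c : rat) :
  c <= -2 -> PrePer (quad c) `<=` Qtr R.
Proof.
move=> c2 a; rewrite PrePer_quad => /= pa.
have [q [qa qm _]] := minCpolyP a; exists q => //.
have [rs E] := closed_field_poly_normal (map_poly ratr q : {poly R[i]}).
have [b b2 cb] := fixed_point_ge2 R[i] c2.
rewrite lead_coef_map (monicP qm) rmorph1 scale1r in E.
have rsR z : z \in rs -> z = (complex.Re z)%:C%C.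
  move=> zrs; have /complex_realP[k ->//] : z \is Num.real.
  apply: (preper_real b2); rewrite -cb; apply: preper_conjugate qa pa _.
  by rewrite E root_prod_XsubC.
exists [seq complex.Re z | z <- rs].
apply: (map_poly_inj (real_complex R)).
rewrite -map_poly_comp (eq_map_poly (fmorph_eq_rat _)) E big_map rmorph_prod.
by apply: eq_big_seq => z /rsR Ez; rewrite {1}Ez /= map_polyXsubC.
Qed.

Lemma PrePer_infinite (c : rat) : c <= -2 -> infinite_set (PrePer (quad c)).
Proof.
move=> c2; have [b b2 cb] := fixed_point_ge2 algC c2.
pose f := qmap (ratr c : algC).
pose x k := iter k (fun y => sqrtC (y - ratr c)) (- b).
have fx k : f (x k.+1) = x k by rewrite /f /qmap /= sqrtCK subrK.
have fb : f b = b by rewrite /f /qmap cb; ring.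
have fNb : f (- b) = b by rewrite /f /qmap cb; ring.
have bNb : - b != b.
  have b0 : 0 < b by apply: lt_le_trans b2.
  by rewrite lt_eqF // (lt_trans _ b0) // oppr_lt0.
have xk k : iter k f (x k) = - b by elim: k => // k IHk; rewrite iterSr fx.
have fkb k : iter k f b = b by elim: k => // k IHk; rewrite iterS IHk.
have xP k : preper (ratr c) (x k).
  by exists k.+1, k.+2; split=> //; rewrite !iterS xk -/f fNb fb.
(* If [x j = x k] with [j < k], then [f^k] sends it to [-b] as [x k], but to [b] as [x j], whose
   orbit has already passed through [-b]. *)
have xneq j k : (j < k)%N -> x j != x k.
  move=> jk; apply: contra_neq bNb => E; rewrite -{1}(xk k) -E.
  by rewrite -(subnK jk) addnS -addSn iterD xk iterSr fNb fkb.
have xinj : injective x.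
  move=> j k E; case: (ltngtP j k) => // /xneq; rewrite E eqxx //.
rewrite PrePer_quad => fin; apply: infinite_nat.
apply: sub_finite_set (finite_preimage (in2W xinj) fin) => k _; exact: xP.
Qed.

(** * A totally real fixed point for [c <= 1/4] *)

Lemma PrePer_Qtr_nonempty (R : realType) (c : rat) :
  c <= 1 / 4 -> PrePer (quad c) `&` Qtr R !=set0.
Proof.
move=> c4.
have s0 : 0 <= 1 - 4 * ratr c :> R.
  have -> : 1 - 4 * ratr c = ratr (1 - 4 * c) :> R.
    by rewrite rmorphB rmorphM /= rmorph1 rmorph_nat.
  by rewrite ler0q; lra.
pose a : algC := (1 + sqrtC (1 - 4 * ratr c)) / 2.
have fa : a ^+ 2 - a + ratr c = 0.
  rewrite /a; have := sqrtCK (1 - 4 * ratr c : algC); move: (sqrtC _) => s E.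
  have -> : ratr c = (1 - s ^+ 2) / 4 :> algC by rewrite E; field.
  by field.
exists a; split.
  rewrite PrePer_quad; exists 0%N, 1%N; split=> //=; rewrite /qmap.
  by apply/eqP; rewrite -subr_eq0 -fa; apply/eqP; ring.
have [q [qa qm qP]] := minCpolyP a; exists q => //.
pose s := Num.sqrt (1 - 4 * ratr c : R).
have sE : s ^+ 2 = 1 - 4 * ratr c by rewrite sqr_sqrtr.
have : q %| 'X^2 - 'X + c%:P.
  rewrite -qP rmorphD rmorphB /= map_polyXn map_polyX map_polyC.
  by rewrite rootE !hornerE fa.
(* The quadratic splits over [R] with roots [u] and [1 - u], so its divisor [q] is the product over
   a sublist of these. *)
rewrite -(dvdp_map (@ratr R)) rmorphD rmorphB /= map_polyXn map_polyX map_polyC.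
pose u := (1 + s) / 2.
have -> : 'X^2 - 'X + (ratr c)%:P = \prod_(r <- [:: u; 1 - u]) ('X - r%:P).
  have -> : ratr c = u * (1 - u) by rewrite /u; field: sE.
  by rewrite big_cons big_seq1 polyCM polyCB; ring.
case/dvdp_prod_XsubC => m; rewrite eqp_monic ?monic_map //; last first.
  exact: monic_prod_XsubC.
by move=> /eqP E; exists (mask m [:: u; 1 - u]).
Qed.

(** * Discriminants *)

(* The trace of multiplication by [X ^ k] on [Q[X] / (p)], for [d = deg p]. *)
Definition modp_trace (p : {poly rat}) (d k : nat) : rat :=
  \sum_(j < d) ('X^(j + k) %% p)`_j.

(* The discriminant as the Gram determinant of the trace form: a rational number
   computed from [p] alone, so it can be compared in [algC] and in [R]. *)
Definition discr (p : {poly rat}) (d : nat) : rat :=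
  \det (\matrix_(k < d, l < d) modp_trace p d (k + l)).

Definition seq_Vandermonde (L : nzRingType) (rs : seq L) : 'M[L]_(size rs) :=
  Vandermonde (size rs) (\row_i rs`_i).

Lemma det_seq_Vandermonde_neq0 (L : idomainType) (rs : seq L) :
  uniq rs -> \det (seq_Vandermonde rs) != 0.
Proof.
move=> urs; rewrite det_Vandermonde; apply/prodf_neq0 => i _.
apply/prodf_neq0 => j ij; rewrite !mxE subr_eq0 nth_uniq //.
by rewrite gtn_eqF.
Qed.

(** Shows that the power sums do not depend on the field in which [p] splits. *)
Lemma power_sum_modp_trace (L : numFieldType) (p : {poly rat}) (rs : seq L) k :
  map_poly ratr p = \prod_(r <- rs) ('X - r%:P) -> uniq rs ->
  \sum_(i < size rs) rs`_i ^+ k = ratr (modp_trace p (size rs) k).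
Proof.
move=> E urs; set d := size rs; set V := seq_Vandermonde rs.
have Vu : V \in unitmx by rewrite unitmxE unitfE det_seq_Vandermonde_neq0.
have szp : size p = d.+1 by rewrite -(size_map_poly (@ratr L)) E size_prod_XsubC.
have p0 : p != 0 by rewrite -size_poly_gt0 szp.
pose B : 'M[L]_d := \matrix_(j, l) ratr ('X^(j + k) %% p)`_l.
pose D : 'rV[L]_d := \row_i rs`_i ^+ k.
(* The columns of [V] are eigenvectors of multiplication by [X ^ k]. *)
have BV : B *m V = V *m diag_mx D.
  apply/matrixP => j i; rewrite mul_mx_diag !mxE -exprD.
  set m := 'X^(j + k) %% p.
  have szm : (size (map_poly ratr m : {poly L}) <= d)%N.
    by rewrite size_map_poly -ltnS -szp ltn_modp.
  transitivity (map_poly ratr m).[rs`_i].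
    by rewrite (horner_coef_wide _ szm); apply: eq_bigr => l _; rewrite !mxE coef_map.
  have := congr1 (fun g => (map_poly ratr g).[rs`_i]) (divp_eq 'X^(j + k) p).
  rewrite rmorphD rmorphM /= map_polyXn hornerD hornerM hornerXn.
  have /rootP -> : root (map_poly ratr p) rs`_i by rewrite E root_prod_XsubC mem_nth.
  by rewrite mulr0 add0r => ->.
have : \tr B = \tr (diag_mx D).
  by rewrite -[B](mulmxK Vu) BV mxtrace_mulC mulmxA mulVmx // mul1mx.
rewrite mxtrace_diag => TB.
rewrite /modp_trace rmorph_sum; apply: etrans (etrans (esym TB) _).
  by apply: eq_bigr => i _; rewrite mxE.
by apply: eq_bigr => i _; rewrite mxE.
Qed.

(** The product of the Vandermonde matrix with its transpose has the power sums as entries. *)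
Lemma det_seq_Vandermonde_sqr (L : numFieldType) (p : {poly rat}) (rs : seq L) :
  map_poly ratr p = \prod_(r <- rs) ('X - r%:P) -> uniq rs ->
  (\det (seq_Vandermonde rs)) ^+ 2 = ratr (discr p (size rs)).
Proof.
move=> E urs; rewrite expr2 -{2}det_tr -det_mulmx -det_map_mx; congr (\det _).
apply/matrixP => k l; rewrite !mxE /= -(power_sum_modp_trace _ E urs).
by apply: eq_bigr => i _; rewrite !mxE exprD.
Qed.

(** The change of basis from monomials to the [P k] is unitriangular. *)
Lemma det_monic_basis (L : comNzRingType) (P : nat -> {poly L}) (rs : seq L) :
  (forall k, P k \is monic) -> (forall k, size (P k) = k.+1) ->
  \det (\matrix_(k < size rs, i < size rs) (P k).[rs`_i])
  = \det (seq_Vandermonde rs).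
Proof.
move=> Pm Ps; set M := \matrix_(_, _) _.
pose T : 'M[L]_(size rs) := \matrix_(k, j) (P k)`_j.
have -> : M = T *m seq_Vandermonde rs.
  apply/matrixP => k i; rewrite !mxE (@horner_coef_wide _ (size rs)) ?Ps //.
  by apply: eq_bigr => j _; rewrite !mxE.
rewrite det_mulmx det_trig; last first.
  by apply/is_trig_mxP => i j ij; rewrite mxE nth_default ?Ps.
rewrite big1 ?mul1r // => i _; rewrite mxE.
by move/monicP: (Pm i); rewrite lead_coefE Ps.
Qed.

(** * Integrality and the lower bound for the discriminant *)

Lemma monic_sqrDC (L : idomainType) (g : {poly L}) (k : L) m :
  (0 < m)%N -> g \is monic -> size g = m.+1 ->
  (g ^+ 2 + k%:P \is monic) /\ size (g ^+ 2 + k%:P) = (m.*2).+1.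
Proof.
move=> m0 gm sg.
have sg2 : size (g ^+ 2) = (m.*2).+1.
  by rewrite expr2 size_monicM ?monic_neq0 // sg /= addnS addnn.
have lt : (size k%:P < size (g ^+ 2))%N.
  by rewrite sg2 (leq_ltn_trans (size_polyC_leq1 _)) // ltnS double_gt0.
by rewrite size_polyDl // monicE lead_coefDl // -monicE monic_exp.
Qed.

Lemma size_qiter (c : rat) n : qiter c n \is monic /\ size (qiter c n) = (2 ^ n).+1.
Proof.
elim: n => [|n [IHm IHs]]; first by rewrite /= monicX size_polyX.
by rewrite expnS mul2n; apply: monic_sqrDC => //; rewrite expn_gt0.
Qed.

(* [b ^ 2 ^ n * f ^ n (y / b)] is a monic integral polynomial in [y], where [b] is the
   denominator of [c]. *)
Lemma preper_Aint (c : rat) (z : algC) :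
  preper (ratr c) z -> (denq c)%:~R * z \in Aint.
Proof.
pose A : int := numq c; pose B : int := denq c.
pose b : algC := B%:~R.
have b0 : b != 0 by rewrite intr_eq0 denq_neq0.
have cAB : ratr c = A%:~R / b by [].
(* [G n] is [b^(2^n) f^n(y / b)]; one factor [b] cancels against the denominator of [c], whence the
   predecessor in the exponent. *)
pose fix G n : {poly int} := if n is n'.+1
  then G n' ^+ 2 + (A * B ^+ (2 ^ n).-1)%:P else 'X.
have GP n : G n \is monic /\ size (G n) = (2 ^ n).+1.
  elim: n => [|n [IHm IHs]]; first by rewrite /= monicX size_polyX.
  by rewrite expnS mul2n; apply: monic_sqrDC => //; rewrite expn_gt0.
have GE n : (map_poly intr (G n)).[b * z] = b ^+ (2 ^ n) * iter n (qmap (ratr c)) z.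
  elim: n => [|n IHn]; first by rewrite /= map_polyX hornerX.
  rewrite iterS {2}/qmap cAB /= rmorphD rmorphXn /= map_polyC /= rmorphM rmorphXn /=.
  rewrite hornerD hornerC horner_exp IHn -cAB -/b.
  have -> : b ^+ (2 ^ n.+1) = b * b ^+ (2 ^ n.+1).-1.
    by rewrite -exprS prednK ?expn_gt0.
  rewrite mulrDr exprMn -exprM mulnC -expnS; congr (_ + _).
    by rewrite -exprS prednK ?expn_gt0.
  by rewrite cAB; field.
(* The factor [B^k] equalizes the scalings of [G n] and [G m], so [h] vanishes at [b z]; it is monic
   because [G m] has smaller degree. *)
case=> m [n [mn E]]; pose k := (2 ^ n - 2 ^ m)%N.
pose h := G n - B ^+ k *: G m.
have szlt : (size (- (B ^+ k *: G m)) < size (G n))%N.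
  rewrite size_polyN (leq_ltn_trans (size_scale_leq _ _)) //.
  by rewrite (GP n).2 (GP m).2 ltnS ltn_exp2l.
apply: (@root_monic_Aint (map_poly intr h)).
- rewrite rootE rmorphB /= map_polyZ /= rmorphXn /= hornerD hornerN hornerZ !GE E.
  by rewrite mulrA -exprD subnK ?subrr // leq_exp2l // ltnW.
- by apply: monic_map; rewrite monicE lead_coefDl // -monicE (GP n).1.
- by apply/polyOverP => i; rewrite coef_map intr_int.
Qed.

Lemma det_Aint n (M : 'M[algC]_n) : (forall i j, M i j \in Aint) -> \det M \in Aint.
Proof.
by move=> MA; rewrite rpred_sum // => s _; rewrite rpredMsign rpred_prod.
Qed.

(** The scaled determinant is an algebraic integer whose square is a nonzero rational, hence a
    nonzero integer. *)
Lemma discr_lower_bound (c : rat) (p : {poly rat}) (rs : seq algC) (J : nat) :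
  map_poly ratr p = \prod_(r <- rs) ('X - r%:P) -> uniq rs ->
  (forall z, z \in rs -> preper (ratr c) z) ->
  1 <= (\prod_(k < size rs) (denq c)%:~R ^+ (k %/ 2 ^ J + k %% 2 ^ J)) ^+ 2
       * `|discr p (size rs)|.
Proof.
move=> E urs pre; set d := size rs; set b : rat := (denq c)%:~R.
pose F : {poly algC} := map_poly ratr (qiter c J).
have [Fm0 Fs0] := size_qiter c J.
have Fm : F \is monic by apply: monic_map.
have Fs : size F = (2 ^ J).+1 by rewrite size_map_poly.
(* Values of the iterate [F] at preperiodic points cost one factor [b], although [F] has degree
   [2^J]; so [P k] costs about [k / 2^J] factors instead of [k]. *)
pose P k : {poly algC} := F ^+ (k %/ 2 ^ J) * 'X^(k %% 2 ^ J).
have Pm k : P k \is monic by apply: rpredM; apply: rpredX; rewrite ?monicX.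
have Ps k : size (P k) = k.+1.
  rewrite size_monicM ?monic_exp ?monic_neq0 ?monicXn // size_polyXn addnS /=.
  have -> : size (F ^+ (k %/ 2 ^ J)) = (k %/ 2 ^ J * 2 ^ J).+1.
    have /eqP := size_exp F (k %/ 2 ^ J).
    rewrite Fs /= mulnC => /eqP <-; rewrite prednK // size_poly_gt0.
    by rewrite monic_neq0 ?monic_exp.
  by rewrite addSn -divn_eq.
have := det_monic_basis rs Pm Ps; set M := \matrix_(_, _) _ => detM.
pose e k := (k %/ 2 ^ J + k %% 2 ^ J)%N.
pose D : 'rV[algC]_d := \row_k ratr b ^+ e k.
pose x := \det (diag_mx D *m M).
have xA : x \in Aint.
  apply: det_Aint => k i; rewrite mul_diag_mx !mxE hornerM horner_exp hornerXn.
  rewrite horner_qiter exprD mulrACA -!exprMn /b ratr_int.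
  have pz : preper (ratr c) rs`_i by apply/pre/mem_nth.
  by apply: rpredM; apply: rpredX; apply: preper_Aint => //; apply: preper_iter.
have xE : x ^+ 2 = ratr ((\prod_(k < d) b ^+ e k) ^+ 2 * discr p d).
  rewrite /x det_mulmx detM exprMn (det_seq_Vandermonde_sqr E urs) det_diag.
  rewrite rmorphM rmorphXn rmorph_prod; congr (_ ^+ 2 * _).
  by apply: eq_bigr => k _; rewrite mxE rmorphXn.
have x2int : x ^+ 2 \is a Num.int.
  by apply: Cint_rat_Aint; [rewrite xE Crat_rat | rewrite rpredX].
have x0 : x ^+ 2 != 0.
  rewrite expf_neq0 // /x det_mulmx detM mulf_neq0 ?det_seq_Vandermonde_neq0 //.
  rewrite det_diag; apply/prodf_neq0 => k _; rewrite mxE expf_neq0 //.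
  by rewrite fmorph_eq0 intr_eq0 denq_neq0.
have := norm_intr_ge1 x2int x0.
rewrite xE -ratr_norm -(rmorph1 (@ratr algC)) ler_rat normrM ger0_norm //.
by rewrite exprn_even_ge0.
Qed.

(** * Chebyshev polynomials and the upper bound for the discriminant *)

(* Monic Chebyshev polynomials of the interval [[-2 r, 2 r]]. *)
Fixpoint cheb (R : nzRingType) (r : R) (n : nat) : {poly R} :=
  if n is n1.+1 then
    if n1 is n2.+1 then 'X * cheb r n1 - (r ^+ 2) *: cheb r n2 else 'X
  else 1.

Lemma cheb_monic_size (R : idomainType) (r : R) n :
  cheb r n \is monic /\ size (cheb r n) = n.+1.
Proof.
suff: (cheb r n \is monic /\ size (cheb r n) = n.+1) /\
      (cheb r n.+1 \is monic /\ size (cheb r n.+1) = n.+2) by case.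
elim: n => [|n [IH0 [IHm IHs]]]; first by rewrite /= monic1 size_poly1 monicX size_polyX.
split=> //; rewrite -[cheb r n.+2]/('X * cheb r n.+1 - (r ^+ 2) *: cheb r n).
have sX : size ('X * cheb r n.+1) = n.+3.
  by rewrite size_monicM ?monicX ?monic_neq0 // size_polyX IHs.
have lt : (size (- (r ^+ 2 *: cheb r n)) < size (('X : {poly R}) * cheb r n.+1)%R)%N.
  by rewrite size_polyN (leq_ltn_trans (size_scale_leq _ _)) // sX IH0.2 ltnS leqnSn.
by rewrite size_polyDl // monicE lead_coefDl // -monicE monicMl ?monicX.
Qed.

(** Each step of the recurrence multiplies the quadratic form [u^2 - x u v + r^2 v^2] by [r^2]. *)
Lemma cheb_invariant (R : comNzRingType) (r x : R) n :
  (cheb r n.+1).[x] ^+ 2 - x * (cheb r n).[x] * (cheb r n.+1).[x]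
    + r ^+ 2 * (cheb r n).[x] ^+ 2 = r ^+ n.*2.+2.
Proof.
elim: n => [|n IHn]; first by rewrite /= hornerX hornerC; ring.
rewrite -[cheb r n.+2]/('X * cheb r n.+1 - (r ^+ 2) *: cheb r n).
have -> : r ^+ n.+1.*2.+2 = r ^+ 2 * r ^+ n.*2.+2 by rewrite -exprD.
rewrite -IHn !(hornerD, hornerN, hornerZ, hornerM, hornerX).
move: (cheb r n.+1).[x] (cheb r n).[x] => u v; ring.
Qed.

(** Four times the invariant form equals [(2u - xv)^2 + (4r^2 - x^2) v^2], so for [|x| <= t] it
    controls [v^2] uniformly. *)
Lemma cheb_bound (R : realFieldType) (r t : R) : 0 < r -> 0 <= t < 2 * r ->
  exists2 C : R, 1 <= C &
    forall x n, `|x| <= t -> `|(cheb r n).[x]| <= C * r ^+ n.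
Proof.
move=> r0 /andP[t0 tr]; pose C := 4 * r ^+ 2 / (4 * r ^+ 2 - t ^+ 2).
have den0 : 0 < 4 * r ^+ 2 - t ^+ 2 by nra.
have C1 : 1 <= C by rewrite ler_pdivlMr // mul1r; have := sqr_ge0 t; lra.
exists C => // x n xt.
have C0 : 0 <= C by apply: le_trans C1.
have Cr0 : 0 <= C * r ^+ n by rewrite mulr_ge0 // exprn_ge0 // ltW.
rewrite -(@ler_pXn2r _ 2%N) ?nnegrE //.
rewrite real_normK ?num_real //.
have xt2 : x ^+ 2 <= t ^+ 2 by rewrite -[x ^+ 2]real_normK ?num_real // ler_pXn2r ?nnegrE.
have := cheb_invariant r x n; set u := _.[x]; set v := (cheb r n).[x] => inv.
have -> : (C * r ^+ n) ^+ 2 = C * (C * r ^+ n.*2).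
  by rewrite exprMn -exprM muln2; ring.
have rn0 : 0 <= r ^+ n.*2 by rewrite exprn_ge0 // ltW.
(* The form yields [v^2 <= C r^(2n)]; as [C >= 1], its square root may be replaced by [C]. *)
apply: (@le_trans _ _ (C * r ^+ n.*2)); last by rewrite ler_peMl // mulr_ge0.
rewrite /C mulrAC ler_pdivlMr //.
have -> : 4 * r ^+ 2 * r ^+ n.*2 = 4 * r ^+ n.*2.+2 by rewrite !exprS; ring.
rewrite -inv.
have := sqr_ge0 (2 * u - x * v); have := sqr_ge0 v; nra.
Qed.

(** Leibniz expansion. The factorial is spread over the factors so that everything stays a product
    over [k]. *)
Lemma det_norm_le (R : realDomainType) n (M : 'M[R]_n) (u : nat -> R) :
  (forall i j, `|M i j| <= u i) -> `|\det M| <= \prod_(k < n) (k.+1%:R * u k).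
Proof.
move=> Mu; rewrite big_split /= -natr_prod.
have -> : (\prod_(k < n) k.+1 = n`!)%N.
  by rewrite fact_prod big_add1 big_mkord.
apply: le_trans (ler_norm_sum _ _ _) _.
apply: (@le_trans _ _ (\sum_(s : 'S_n) \prod_(i < n) u i)).
  apply: ler_sum => s _; rewrite normrMsign normr_prod.
  by apply: ler_prod => i _; rewrite normr_ge0 Mu.
by rewrite sumr_const card_Sn mulr_natl.
Qed.

Lemma discr_upper_bound (R : realFieldType) (r t : R) : 0 < r -> 0 <= t < 2 * r ->
  exists2 C : R, 1 <= C &
    forall (p : {poly rat}) (rs : seq R),
      map_poly ratr p = \prod_(x <- rs) ('X - x%:P) -> uniq rs ->
      (forall x, x \in rs -> `|x| <= t) ->
      ratr `|discr p (size rs)| <= (\prod_(k < size rs) (k.+1%:R * (C * r ^+ k))) ^+ 2.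
Proof.
move=> r0 rt; have [C C1 HC] := cheb_bound r0 rt; exists C => // p rs E urs rst.
rewrite ratr_norm -(det_seq_Vandermonde_sqr E urs).
rewrite -(det_monic_basis rs (fun k => (cheb_monic_size r k).1)
  (fun k => (cheb_monic_size r k).2)).
rewrite normrX; set M := \matrix_(_, _) _.
have := @det_norm_le _ _ M (fun k => C * r ^+ k); rewrite /= => H.
have {}H : `|\det M| <= \prod_(k < size rs) (k.+1%:R * (C * r ^+ k)).
  by apply: H => i j; rewrite mxE HC // rst // mem_nth.
by rewrite ler_pXn2r ?nnegrE // (le_trans _ H).
Qed.

(** * Finiteness for [-2 < c <= 1/4] *)

(** Each of the [n + 1] terms of the geometric sum up to [r^n] is at least [r^n]. *)
Lemma natS_expr_le (R : realFieldType) (r : R) n :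
  0 <= r < 1 -> n.+1%:R * r ^+ n <= (1 - r)^-1.
Proof.
move=> /andP[r0 r1]; have r10 : 0 < 1 - r by rewrite subr_gt0.
rewrite -div1r ler_pdivlMr //.
apply: (@le_trans _ _ ((\sum_(i < n.+1) r ^+ i) * (1 - r))).
  rewrite ler_pM2r // mulr_natl -[X in _ *+ X](card_ord n.+1) -sumr_const.
  by apply: ler_sum => i _; rewrite ler_wiXn2l // ?(ltW r1) // -ltnS.
by rewrite mulrC -opprB mulNr -subrX1 opprB gerBl exprn_ge0.
Qed.

Lemma expr_small (R : archiRealFieldType) (r e : R) :
  0 <= r < 1 -> 0 < e -> exists n0, forall n, (n0 <= n)%N -> r ^+ n < e.
Proof.
move=> r01 e0; pose B := (e * (1 - r))^-1.
have r10 : 0 < 1 - r by rewrite subr_gt0; case/andP: r01.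
have B0 : 0 < B by rewrite invr_gt0 mulr_gt0.
exists (Num.bound B) => n nB.
have Bn : B < n.+1%:R.
  apply: lt_le_trans (archi_boundP (ltW B0)) _; rewrite ler_nat.
  exact: leq_trans nB (leqnSn n).
rewrite -(ltr_pM2l (ltr0Sn R n)); apply: le_lt_trans (natS_expr_le _ r01) _.
have -> : (1 - r)^-1 = B * e by rewrite /B; field; rewrite !gt_eqF.
by rewrite ltr_pM2r.
Qed.

(** With [r = q^2], one factor [q^n] keeps [(n + 1) q^n] bounded and the other tends to zero. *)
Lemma natS_expr_small (R : realType) (r e : R) :
  0 <= r < 1 -> 0 < e ->
  exists n0, forall n, (n0 <= n)%N -> n.+1%:R * r ^+ n < e.
Proof.
move=> /andP[r0 r1] e0; pose q := Num.sqrt r.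
have qr : r = q ^+ 2 by rewrite sqr_sqrtr.
have q0 : 0 <= q by exact: sqrtr_ge0.
have q1 : q < 1 by rewrite -[1]sqrtr1 ltr_sqrt.
have q10 : 0 < 1 - q by rewrite subr_gt0.
have [|n0 H] := @expr_small R q (e * (1 - q)) _ (mulr_gt0 e0 q10).
  by rewrite q0.
exists n0 => n /H qn; rewrite qr -exprM mul2n -addnn exprD mulrA.
have q01 : 0 <= q < 1 by rewrite q0.
apply: le_lt_trans (ler_wpM2r (exprn_ge0 n q0) (natS_expr_le n q01)) _.
by rewrite mulrC ltr_pdivrMr.
Qed.

(** The first [K] factors have a fixed product [A]; the others contribute at most a power of [1/2],
    eventually below [1 / (A + 1)]. *)
Lemma prod_small (R : archiRealFieldType) (t : nat -> R) (K : nat) :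
  (forall k, 0 <= t k) -> (forall k, (K <= k)%N -> t k <= 1 / 2) ->
  exists D, forall d, (D <= d)%N -> \prod_(k < d) t k < 1.
Proof.
move=> t0 tK; pose A := \prod_(k < K) t k.
have A0 : 0 <= A by apply: prodr_ge0.
have [||n0 H] := @expr_small R (1 / 2) (A + 1)^-1; first by lra.
  by rewrite invr_gt0 ltr_pwDr.
exists (K + n0)%N => d Dd.
have -> : d = (K + (d - K))%N by rewrite subnKC // (leq_trans _ Dd) ?leq_addr.
rewrite big_split_ord /= -/A.
have A1 : 0 < A + 1 by rewrite ltr_pwDr.
apply: (@le_lt_trans _ _ (A * (A + 1)^-1)); last first.
  by rewrite ltr_pdivrMr // mul1r ltrDl.
rewrite ler_wpM2l //.
have nd : (n0 <= d - K)%N by rewrite leq_subRL // (leq_trans _ Dd) // leq_addr.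
apply: le_trans (ltW (H _ nd)).
rewrite -[X in _ ^+ X]card_ord -prodr_const.
by apply: ler_prod => i _; rewrite t0 tK // leq_addr.
Qed.

Lemma discr_bounds_incompatible (R : realType) (C r b : R) :
  1 <= C -> 0 < r < 1 -> 1 <= b ->
  exists J D, forall d, (D <= d)%N ->
    \prod_(k < d) (b ^+ (k %/ 2 ^ J + k %% 2 ^ J) * (k.+1%:R * (C * r ^+ k))) < 1.
Proof.
move=> C1 /andP[r0 r1] b1.
have b0 : 0 < b by apply: lt_le_trans b1.
have C0 : 0 < C by apply: lt_le_trans C1.
(* Since [2^J > J], this choice makes [s = b r^(2^J)] less than 1. *)
have [||J HJ] := @expr_small R r b^-1; rewrite ?invr_gt0 ?(ltW r0) //.
exists J; set N := (2 ^ J)%N; have N0 : (0 < N)%N by rewrite expn_gt0.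
pose s := b * r ^+ N.
have s01 : 0 <= s < 1.
  apply/andP; split; first by rewrite mulr_ge0 ?exprn_ge0 // ltW.
  by rewrite /s mulrC -ltr_pdivlMr // div1r HJ // ltnW // ltn_expl.
(* For [k = qN + m] with [m < N], the estimates [k + 1 <= N (q + 1)] and [b^m r^m <= b^N] bound the
   factor by [M (q + 1) s^q], which tends to zero. *)
pose M := N%:R * C * b ^+ N.
have M0 : 0 < M by rewrite !mulr_gt0 ?exprn_gt0 ?ltr0n.
have [|q0 Hq] := @natS_expr_small R s (M *+ 2)^-1 s01; first
  by rewrite invr_gt0 pmulrn_lgt0.
apply: (@prod_small R (fun k => b ^+ (k %/ N + k %% N) * (k.+1%:R * (C * r ^+ k)))
  (q0 * N)) => k.
  by rewrite !mulr_ge0 ?exprn_ge0 // ltW.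
move=> qk; have qkN : (q0 <= k %/ N)%N by rewrite leq_divRL.
set q := (k %/ N)%N in qkN *; set m := (k %% N)%N.
have kE : k = (q * N + m)%N by rewrite -divn_eq.
have mN : (m < N)%N by rewrite ltn_mod.
apply: (@le_trans _ _ (M * (q.+1%:R * s ^+ q))); last first.
  rewrite -ler_pdivlMl // (le_trans (ltW (Hq _ qkN))) //.
  by rewrite -mulr_natr invfM mul1r.
have -> : b ^+ (q + m) * (k.+1%:R * (C * r ^+ k))
   = k.+1%:R * ((b ^+ m * r ^+ m) * (C * s ^+ q)).
  by rewrite /s exprMn -exprM {2}kE !exprD mulnC; ring.
have -> : M * (q.+1%:R * s ^+ q) = (N%:R * q.+1%:R) * (b ^+ N * (C * s ^+ q)).
  by rewrite /M; ring.
have Cs0 : 0 <= C * s ^+ q by rewrite mulr_ge0 ?exprn_ge0 ?(ltW C0) //; case/andP: s01.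
have brm : b ^+ m * r ^+ m <= b ^+ N.
  apply: (@le_trans _ _ (b ^+ m)); last by rewrite ler_weXn2l // ltnW.
  by rewrite ler_piMr ?exprn_ge0 ?exprn_ile1 // ltW.
apply: ler_pM => //.
- by rewrite mulr_ge0 // mulr_ge0 ?exprn_ge0 // ltW.
- by rewrite -natrM ler_nat {1}kE mulnS addnC -addSn mulnC leq_add2r.
- exact: ler_wpM2r.
Qed.

(** * Separable rational polynomials with prescribed roots *)

(** The gcd does not vanish at [a], so its cofactor in [q] does and is a multiple of [q]; comparing
    degrees, the gcd is constant. *)
Lemma minCpoly_coprimep (a : algC) (q h : {poly rat}) :
  minCpoly a = map_poly ratr q -> ~~ root (map_poly ratr h) a -> coprimep q h.
Proof.
have [q' [-> qm qP]] := minCpolyP a => /(map_poly_inj _) <- ha {q}.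
have qa : root (map_poly ratr q') a by rewrite qP.
have ga : ~~ root (map_poly ratr (gcdp q' h)) a.
  by apply: contra ha; rewrite !qP => /dvdp_trans; apply; apply: dvdp_gcdr.
have /dvdpP[u Eu] := dvdp_gcdl q' h.
have q0 : q' != 0 by rewrite monic_neq0.
have [u0 g0] : u != 0 /\ gcdp q' h != 0.
  by apply/andP; rewrite -negb_or -mulf_eq0 -Eu.
have : root (map_poly ratr u) a.
  by move: qa; rewrite {1}Eu rmorphM rootM (negPf ga) orbF.
rewrite qP => /dvdp_leq => /(_ u0); rewrite {1}Eu size_mul //.
have := g0; rewrite -size_poly_gt0 => sg.
rewrite /coprimep eqn_leq sg andbT; case: (size (gcdp q' h)) sg => // m _.
by rewrite addnS /= -[leqRHS]addn0 leq_add2l.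
Qed.

Lemma minCpoly_separable (a : algC) (q : {poly rat}) :
  minCpoly a = map_poly ratr q -> separable_poly q.
Proof.
move=> qa; have ra : root (map_poly ratr q) a by rewrite -qa root_minCpoly.
rewrite unlock; apply: (minCpoly_coprimep qa).
have [q' [E qm qP]] := minCpolyP a; move: E ra; rewrite qa => /(map_poly_inj _) -> ra.
have q0 : q' != 0 by rewrite monic_neq0.
have s1 : (1 < size q')%N.
  by rewrite -(size_map_poly (@ratr algC)) (root_size_gt1 _ ra) // map_poly_eq0.
rewrite qP; apply: contraL (lt_size_deriv q0) => /dvdp_leq h; rewrite -leqNgt h //.
have lc : q'`_(size q').-1 = 1 by apply: monicP.
apply/eqP => /(congr1 (coefp (size q').-2)); rewrite /= coef_deriv coef0.
by case: (size q') s1 lc => [|[|m]] // _ /= ->; apply/eqP; rewrite pnatr_eq0.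
Qed.

(** Provides the Galois-stable set as the roots of one rational polynomial: a minimal polynomial is
    multiplied in only when its root is new, which keeps the factors coprime. *)
Lemma separable_common_multiple (R : realType) (c : rat) (s : seq algC) :
  (forall a, a \in s -> preper (ratr c) a /\ totally_real R a) ->
  exists p : {poly rat},
    [/\ p \is monic, separable_poly p,
        exists rs : seq R, map_poly ratr p = \prod_(r <- rs) ('X - r%:P),
        forall (L : numFieldType) (z : L),
          root (map_poly ratr p) z -> preper (ratr c) z &
        forall a, a \in s -> root (map_poly ratr p) a].
Proof.
elim: s => [|a s IHs] H.
  exists 1; split=> //; first exact: monic1.
  - by rewrite unlock derivE coprimep0 // eqpxx.
  - by exists [::]; rewrite rmorph1 big_nil.
  - by move=> L z; rewrite rmorph1 (negPf (root1 z)).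
have [|p [pm ps [rs Ep] pp pr]] := IHs; first
  by move=> x xs; apply: H; rewrite inE xs orbT.
have [pa [q qa [rs' Eq]]] := H a (mem_head _ _).
case: (boolP (root (map_poly ratr p) a)) => [ra|nra].
  exists p; split=> //; first by exists rs.
  by move=> x; rewrite inE => /predU1P[-> // | /pr].
have qm : q \is monic by rewrite -(map_monic (@ratr algC)) -qa minCpoly_monic.
exists (p * q); split.
- by rewrite monicMl.
- by rewrite separable_mul ps (minCpoly_separable qa) coprimep_sym (minCpoly_coprimep qa).
- by exists (rs ++ rs'); rewrite rmorphM /= Ep Eq big_cat.
- move=> L z; rewrite rmorphM rootM => /orP[/pp // | ].
  exact: preper_conjugate qa pa.
- move=> x; rewrite inE rmorphM rootM => /predU1P[-> | /pr -> //].
  by rewrite /= -qa root_minCpoly orbT.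
Qed.

(** One rational [p] is split both over [algC], for the lower bound, and over [R], for the upper
    bound; both concern the same rational [discr]. *)
Lemma preper_totally_real_card_bounded (R : realType) (c : rat) : -2 < c -> c <= 1 / 4 ->
  exists D, forall s : seq algC, uniq s ->
    (forall a, a \in s -> preper (ratr c) a /\ totally_real R a) -> (size s < D)%N.
Proof.
(* This [t] satisfies [1 <= t < 2] and [t^2 - t + c = ((c + 2) / 3)^2]; [r] is the midpoint of
   [t / 2] and 1. *)
move=> c2 c4; pose t : R := ratr ((4 - c) / 3); pose r : R := ratr ((10 - c) / 12).
have r01 : 0 < r < 1.
  rewrite ltr0q -(rmorph1 (@ratr R)) ltr_rat; apply/andP; split; lra.
have t1 : 1 <= t by rewrite -(rmorph1 (@ratr R)) ler_rat; lra.
have rt : 0 <= t < 2 * r.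
  have -> : 2 * r = ratr (2 * ((10 - c) / 12)) by rewrite rmorphM /= rmorph_nat.
  by rewrite (le_trans ler01) //= ltr_rat; lra.
have tc : 0 < t ^+ 2 - t + ratr c.
  rewrite /t -rmorphXn -rmorphB -rmorphD /= ltr0q.
  have -> : ((4 - c) / 3) ^+ 2 - (4 - c) / 3 + c = ((c + 2) / 3) ^+ 2 by field.
  by rewrite exprn_gt0 //; lra.
have [r0 _] := andP r01.
have [C C1 HC] := discr_upper_bound r0 rt.
pose b : R := (denq c)%:~R.
have b1 : 1 <= b by rewrite ler1z -gtz0_ge1 denq_gt0.
have [J [D HD]] := discr_bounds_incompatible C1 r01 b1.
exists D => s us Hs; rewrite ltnNge; apply/negP => Ds.
have [p [pm ps [rs Ep] pp pr]] := separable_common_multiple Hs.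
have [zs Ez] := closed_field_poly_normal (map_poly ratr p : {poly algC}).
rewrite lead_coef_map (monicP pm) rmorph1 scale1r in Ez.
have uzs : uniq zs by rewrite -separable_prod_XsubC -Ez separable_map.
have urs : uniq rs by rewrite -separable_prod_XsubC -Ep separable_map.
have szE : size zs = size rs.
  apply: succn_inj; rewrite -!(size_prod_XsubC _ id) /= -Ez -Ep.
  by rewrite !size_map_poly.
have Dz : (D <= size zs)%N.
  apply: leq_trans Ds (uniq_leq_size us _) => a /pr.
  by rewrite Ez root_prod_XsubC.
have low : 1 <= (\prod_(k < size zs) (denq c)%:~R ^+ (k %/ 2 ^ J + k %% 2 ^ J)) ^+ 2
     * `|discr p (size zs)|.
  by apply: discr_lower_bound => // z; rewrite -root_prod_XsubC -Ez; apply: pp.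
have up : ratr `|discr p (size rs)|
    <= (\prod_(k < size rs) (k.+1%:R * (C * r ^+ k))) ^+ 2.
  apply: HC => // x; rewrite -root_prod_XsubC -Ep => /pp px.
  exact: ltW (preper_real_le t1 tc px).
have small := HD _ Dz.
move: low; rewrite -(ler_rat R) rmorph1 rmorphM rmorphXn rmorph_prod /=.
rewrite (eq_bigr (fun k : 'I__ => b ^+ (k %/ 2 ^ J + k %% 2 ^ J))); last first.
  by move=> k _; rewrite rmorphXn /= ratr_int.
rewrite leNgt => /negP; apply.
rewrite szE in small *.
(* Multiplied together, the two bounds become the square of the product already shown to be less
   than 1. *)
apply: le_lt_trans (ler_wpM2l (sqr_ge0 _) up) _.
rewrite -exprMn -big_split /= expr_lt1 //.
have C0 : 0 <= C by apply: le_trans C1.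
apply: prodr_ge0 => k _; rewrite !mulr_ge0 ?exprn_ge0 // ?ltW //.
by apply: lt_le_trans b1.
Qed.

Lemma PrePer_Qtr_finite (R : realType) (c : rat) : -2 < c -> c <= 1 / 4 ->
  finite_set (PrePer (quad c) `&` Qtr R).
Proof.
move=> c2 c4; have [D HD] := preper_totally_real_card_bounded R c2 c4.
apply: contrapT => /(infinite_set_fset D)[B BS].
rewrite leqNgt HD ?finmap.fset_uniq // => a aB; have := BS a aB.
by rewrite PrePer_quad => -[].
Qed.

Theorem theorem1p1 (R : realType) (c : rat) :
  (1 / 4 < c -> PrePer (quad c) `&` Qtr R = set0) /\
  (-2 < c /\ c <= 1 / 4 ->
     PrePer (quad c) `&` Qtr R !=set0 /\
     finite_set (PrePer (quad c) `&` Qtr R)) /\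
  (c <= -2 ->
     PrePer (quad c) `<=` Qtr R /\
     infinite_set (PrePer (quad c) `&` Qtr R)).
Proof.
split; first exact: PrePer_Qtr_empty.
split=> [[c2 c4]|c2].
  by split; [apply: PrePer_Qtr_nonempty | apply: PrePer_Qtr_finite].
have sub := @PrePer_sub_Qtr R c c2; split=> //.
by rewrite setIidl //; apply: PrePer_infinite.
Qed.
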